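(* Let $k\ge2$ and let $\widetilde{\Pi}^{(k)}$ be the set of open partition diagrams containing neither an enhanced $(k+1)$-nesting nor a future enhanced $(k+1)$-nesting. To each diagram $\pi$ associate the label $\ell(\pi)=[s_0,\dots,s_{k-1}]$, where $s_i$ is the number of semi-arcs of $\pi$ with enhanced nesting index $\ge i$. Consider the generating tree with root label $[0,0,\dots,0]$ and succession rule sending $[s_0,s_1,\dots,s_{k-1}]$ to the following labels: (1) $[s_0,s_0,s_2,\dots,s_{k-1}]$; (2) $[s_0+1,s_1,\dots,s_{k-1}]$; (3) $[s_0,s_1-1,\dots,s_{j-1}-1,i,s_{j+1},\dots,s_{k-1}]$ for each $1\le j\le k-1$ and each $i$ with $s_j\le i\le s_{j-1}-1$; (4) $[s_0-1,s_1-1,\dots,s_{j-1}-1,i,s_{j+1},\dots,s_{k-1}]$ for each $1\le j\le k-1$ and each $i$ with $s_j\le i\le s_{j-1}-1$; (5) $[s_0,s_1-1,\dots,s_{k-1}-1]$ and $[s_0-1,s_1-1,\dots,s_{k-1}-1]$, if $s_{k-1}>0$. Then for every $n\ge0$ the number of diagrams in $\widetilde{\Pi}^{(k)}$ of size $n$ equals the number of nodes at level $n$ of this generating tree.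
   Context: An open partition diagram of size $n\ge 0$ consists of vertices $1,\dots,n$ in a row, a set of arcs $(a,b)$ with $1\le a<b\le n$ and a set of semi-arcs $(a,* )$ with $1\le a\le n$ (a semi-arc has a left end-point but no right end-point), such that every vertex is the left end-point of at most one arc or semi-arc and the right end-point of at most one arc. (Equivalently: a set partition of $\{1,\dots,n\}$ with each block marked closed or open; block $\{a_1<\dots<a_r\}$ gives arcs $(a_1,a_2),\dots,(a_{r-1},a_r)$ and, if open, the semi-arc $(a_r,* )$.) A fixed point is a vertex incident to no arc and no semi-arc. A $k$-nesting is a set of $k$ arcs $(i_1,j_1),\dots,(i_k,j_k)$ with $i_1<\dots<i_k<j_k<\dots<j_1$. An enhanced $k$-nesting is either a $k$-nesting, or a set of $k-1$ arcs $(i_1,j_1),\dots,(i_{k-1},j_{k-1})$ together with a fixed point $i_k$ such that $i_1<\dots<i_{k-1}<i_k<j_{k-1}<\dots<j_1$. A future enhanced $k$-nesting is an enhanced $(k-1)$-nesting together with a semi-arc whose left end-point is smaller than all vertices involved in that enhanced $(k-1)$-nesting. The enhanced nesting index of a semi-arc is the largest $j\ge0$ such that the semi-arc belongs to a future enhanced $(j+1)$-nesting ($0$ if none). A generating tree with root label $L_0$ and a succession rule (assigning to each label a finite list of labels, with multiplicity) is the rooted tree whose root, at level $0$, has label $L_0$, and in which each node with label $L$ has one child for each entry of the list assigned to $L$, labelled by that entry; level $n$ consists of the nodes at distance $n$ from the root. *)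

(* Defs.v *)
From HB Require Import structures.
From mathcomp Require Import all_boot.

Set Implicit Arguments.
Unset Strict Implicit.
Unset Printing Implicit Defensive.

(** * Open partition diagrams *)

(** Vertices are numbered from 0, i.e. they are the elements of ['I_n]; the
    pair [(a, b)] is the arc from [a] to [b], and a semi-arc [(a, * )] is
    represented by its left end-point [a]. *)
Definition is_open_diagram n (A : {set 'I_n * 'I_n}) (S : {set 'I_n}) : bool :=
  [&& [forall e in A, e.1 < e.2],
      [forall v : 'I_n, #|[set e in A | e.1 == v]| + (v \in S) <= 1]
    & [forall v : 'I_n, #|[set e in A | e.2 == v]| <= 1]].

Record open_diagram n := OpenDiagram {
  diagram_val :> {set 'I_n * 'I_n} * {set 'I_n};
  diagramP : is_open_diagram diagram_val.1 diagram_val.2 }.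

HB.instance Definition _ n := [isSub for @diagram_val n].
HB.instance Definition _ n := [Finite of open_diagram n by <:].

Definition arcs n (d : open_diagram n) : {set 'I_n * 'I_n} := d.1.
Definition semiarcs n (d : open_diagram n) : {set 'I_n} := d.2.

Definition fixed_point n (d : open_diagram n) (v : 'I_n) : bool :=
  (v \notin semiarcs d) && [forall e in arcs d, (e.1 != v) && (e.2 != v)].

(** * Nestings *)

(** Arcs are listed from the outermost to the innermost one; the innermost
    inequality [i_k < j_k] holds because [(i_k, j_k)] is an arc. *)
Definition is_nesting n (d : open_diagram n) (t : seq ('I_n * 'I_n)) : bool :=
  all (fun e => e \in arcs d) t &&
  sorted (fun e f : 'I_n * 'I_n => (e.1 < f.1) && (f.2 < e.2)) t.

(** Candidates for enhanced [k]-nestings: [k] arcs, or [k - 1] arcs and a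
    vertex. *)
Definition enhanced_config n k : finType :=
  (k.-tuple ('I_n * 'I_n) + k.-1.-tuple ('I_n * 'I_n) * 'I_n)%type.

(** The condition [0 < k] excludes the degenerate second case for [k = 0],
    where [k - 1] is truncated: the only enhanced 0-nesting is empty. *)
Definition is_enhanced_nesting n k (d : open_diagram n)
    (x : enhanced_config n k) : bool :=
  match x with
  | inl t => is_nesting d t
  | inr (t, v) =>
      [&& 0 < k, is_nesting d t, fixed_point d v
        & all (fun e : 'I_n * 'I_n => e.1 < v < e.2) t]
  end.

Definition config_vertices n k (x : enhanced_config n k) : seq 'I_n :=
  match x with
  | inl t => [seq e.1 | e <- t] ++ [seq e.2 | e <- t]
  | inr (t, v) => v :: [seq e.1 | e <- t] ++ [seq e.2 | e <- t]
  end.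

Definition has_enhanced_nesting n k (d : open_diagram n) : bool :=
  [exists x : enhanced_config n k, is_enhanced_nesting d x].

(** The semi-arc at [a] belongs to a future enhanced [k]-nesting ([k >= 1]). *)
Definition in_future_enhanced_nesting n k (d : open_diagram n) (a : 'I_n)
    : bool :=
  [&& 0 < k, a \in semiarcs d
    & [exists x : enhanced_config n k.-1,
         is_enhanced_nesting d x && all (fun v : 'I_n => a < v) (config_vertices x)]].

Definition has_future_enhanced_nesting n k (d : open_diagram n) : bool :=
  [exists a, in_future_enhanced_nesting k d a].

Definition Pi_tilde k n : {set open_diagram n} :=
  [set d | ~~ has_enhanced_nesting k.+1 d
           && ~~ has_future_enhanced_nesting k.+1 d].

(** * Labels *)

(** A future enhanced [(j+1)]-nesting involves at least [j + 1] vertices, so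
    that only [j < n] can occur and the bound below is harmless. *)
Definition enhanced_nesting_index n (d : open_diagram n) (a : 'I_n) : nat :=
  \max_(j < n.+1 | in_future_enhanced_nesting j.+1 d a) j.

Definition diagram_label k n (d : open_diagram n) : seq nat :=
  mkseq (fun i => #|[set a in semiarcs d | i <= enhanced_nesting_index d a]|) k.

(** * Generating trees *)

(** The labels, with multiplicity, of the nodes at distance [n] from the root:
    each node of level [n] has one child for each entry of the list which
    [rule] assigns to its label. *)
Fixpoint tree_level (L : Type) (rule : L -> seq L) (root : L) (n : nat)
    : seq L :=
  if n is m.+1 then flatten [seq rule l | l <- tree_level rule root m]
  else [:: root].

(** [s] stands for the label [[s 0, ..., s (k - 1)]].  All labels reachable from
    [[0, ..., 0]] are non-increasing and an index [i] with
    [s j <= i < s j.-1] exists only if [s j.-1 > 0], so the truncated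
    predecessors below are only ever applied to positive entries. *)
Definition enhanced_rule k (l : seq nat) : seq (seq nat) :=
  let s m := nth 0 l m in
  let rule1 := mkseq (fun m => if m == 1 then s 0 else s m) k in
  let rule2 := mkseq (fun m => if m == 0 then (s 0).+1 else s m) k in
  let rule3 j i :=
    mkseq (fun m => if m == 0 then s 0
                    else if m < j then (s m).-1
                    else if m == j then i else s m) k in
  let rule4 j i :=
    mkseq (fun m => if m < j then (s m).-1
                    else if m == j then i else s m) k in
  let rule5a := mkseq (fun m => if m == 0 then s 0 else (s m).-1) k in
  let rule5b := mkseq (fun m => (s m).-1) k in
  [:: rule1; rule2]
  ++ [seq rule3 j i | j <- index_iota 1 k, i <- index_iota (s j) (s j.-1)]
  ++ [seq rule4 j i | j <- index_iota 1 k, i <- index_iota (s j) (s j.-1)]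
  ++ (if 0 < s k.-1 then [:: rule5a; rule5b] else [::]).

(* Main.v *)
(** The children of a diagram are obtained by adding a last vertex, which is a
    fixed point, only opens a semi-arc, or closes a semi-arc (possibly opening
    another one).  Closing a semi-arc [c] of enhanced nesting index [j - 1] makes
    the new arc the outermost one of an enhanced [j]-nesting, so the semi-arcs to
    the left of [c] get index at least [j] and nothing else changes.  As indices
    decrease from left to right, [c] has index [j - 1] iff the number [i] of
    semi-arcs to its left satisfies [s_j <= i < s_(j-1)], and the new label is
    given by rules (3)-(4).  For [j = k] no semi-arc may remain to the left of
    [c], whence rule (5).  So the labels of level [n] form the same multiset as
    the labels of the diagrams of size [n]. *)

Require Import Defs.
From mathcomp Require Import all_boot.
From mathcomp Require Import zify.

Set Implicit Arguments.
Unset Strict Implicit.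
Unset Printing Implicit Defensive.

(** * Open diagrams and enhanced nestings peeled from the outside *)

Lemma is_open_diagramP n (A : {set 'I_n * 'I_n}) (S : {set 'I_n}) :
  reflect [/\ forall e, e \in A -> e.1 < e.2,
              forall a b b', (a, b) \in A -> (a, b') \in A -> b = b',
              forall a b, (a, b) \in A -> a \notin S
            & forall a a' b, (a, b) \in A -> (a', b) \in A -> a = a']
          (is_open_diagram A S).
Proof.
apply: (iffP and3P) => [[/'forall_implyP ltA /forallP outA /forallP inA]
                       |[ltA outA semA inA]].
- split=> [e eA|a b b' ab ab'|a b ab|a a' b ab a'b].
  + exact: ltA.
  + have /card_le1_eqP le1 := leq_trans (leq_addr _ _) (outA a).
    suff [] : (a, b) = (a, b') by [].
    by apply: le1; rewrite inE ?ab ?ab' eqxx.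
  + apply/negP => aS; have := outA a.
    rewrite aS addn1 ltnS leqn0 cards_eq0 => /eqP/setP/(_ (a, b)).
    by rewrite !inE ab eqxx.
  + have /card_le1_eqP le1 := inA b.
    suff [] : (a, b) = (a', b) by [].
    by apply: le1; rewrite inE ?ab ?a'b eqxx.
- split; first exact/'forall_implyP.
  + apply/forallP => v; case: (boolP (v \in S)) => vS.
      rewrite addn1 ltnS leqn0 cards_eq0; apply/eqP/setP => -[a b].
      rewrite !inE; apply/negP => /andP[/semA aS /eqP /= av].
      by rewrite av vS in aS.
    rewrite addn0; apply/card_le1_eqP => -[a b] [a' b'].
    rewrite !inE /= => /andP[ab /eqP av] /andP[ab' /eqP a'v].
    by subst a a'; rewrite (outA _ _ _ ab ab').
  + apply/forallP => v; apply/card_le1_eqP => -[a b] [a' b'].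
    rewrite !inE /= => /andP[ab /eqP bv] /andP[a'b /eqP b'v].
    by subst b b'; rewrite (inA _ _ _ ab a'b).
Qed.

Lemma arc_lt n (d : open_diagram n) e : e \in arcs d -> e.1 < e.2.
Proof. by case/is_open_diagramP: (diagramP d) => + _ _ _ => /[apply]. Qed.

(** Peeling off the outermost arc: [nest d j a u] decides whether [d] has an
    enhanced [j]-nesting with all its vertices in [[a, u)]. *)
Fixpoint nest n (d : open_diagram n) j a u : bool :=
  if j is i.+1 then
    [exists e in arcs d, [&& a <= e.1, e.2 < u & nest d i e.1.+1 e.2]]
    || (i == 0) && [exists v, fixed_point d v && (a <= v < u)]
  else true.

Arguments nest : simpl never.

Section NestTheory.

Variables (n : nat) (d : open_diagram n).

Lemma nest_arc j a u e : e \in arcs d -> a <= e.1 -> e.2 < u ->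
  nest d j e.1.+1 e.2 -> nest d j.+1 a u.
Proof.
by move=> eA ae eu dj; apply/orP; left; apply/existsP; exists e; rewrite eA ae eu.
Qed.

Lemma nest_fixed a u v : fixed_point d v -> a <= v < u -> nest d 1 a u.
Proof.
by move=> fv av; apply/orP; right; apply/existsP; exists v; rewrite fv.
Qed.

Lemma nestSP j a u :
  nest d j.+1 a u ->
    (exists e, [/\ e \in arcs d, a <= e.1, e.2 < u & nest d j e.1.+1 e.2])
    \/ j = 0 /\ exists v, fixed_point d v /\ a <= v < u.
Proof.
case/orP=> [/existsP[e /and4P[eA ae eu dj]]|/andP[/eqP j0 /existsP[v /andP[fv av]]]].
  by left; exists e.
by right; split=> //; exists v.
Qed.

(** Every peeled arc raises the left bound, and the innermost arc or fixed point still needs room.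
    For [j = 0] this fails, since [nest] then holds even on an empty window. *)
Lemma nest_bound j a u : 0 < j -> nest d j a u -> a + j <= u.
Proof.
elim: j a u => // j IH a u _ /nestSP[[e [eA ae eu dj]]|[-> [v [_]]]]; last by lia.
have := arc_lt eA; case: j IH dj => [|j] IH dj; first by lia.
by have := IH _ _ (ltn0Sn _) dj; lia.
Qed.

Lemma nest_weaken j a a' u : a' <= a -> nest d j a u -> nest d j a' u.
Proof.
case: j => // j a'a /nestSP[[e [eA ae eu dj]]|[-> [v [fv /andP[av vu]]]]].
  exact: nest_arc (leq_trans a'a ae) _ dj.
by apply: nest_fixed fv _; rewrite vu (leq_trans a'a).
Qed.

(** Dropping the innermost arc or fixed point leaves a plain nesting of arcs. *)
Lemma nest_pred j a u : nest d j.+1 a u -> nest d j a u.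
Proof.
elim: j a u => // j IH a u /nestSP[[e [eA ae eu dj]]|[]//].
by apply: nest_arc eA ae eu _; apply: IH.
Qed.

Lemma nest_le i j a u : i <= j -> nest d j a u -> nest d i a u.
Proof.
move=> /subnK <-; elim: (j - i) => // m IH; rewrite addSn => /nest_pred.
exact: IH.
Qed.

Lemma is_nesting_cons e t :
  is_nesting d (e :: t) =
  [&& e \in arcs d, all (fun f : 'I_n * 'I_n => (e.1 < f.1) && (f.2 < e.2)) t & is_nesting d t].
Proof.
rewrite /is_nesting /= path_sortedE.
  by rewrite -!andbA; do !bool_congr.
by move=> x y z /andP[? ?] /andP[? ?]; apply/andP; split; lia.
Qed.

Lemma nest_config j (x : enhanced_config n j) a u :
  is_enhanced_nesting d x -> all (fun v : 'I_n => a <= v < u) (config_vertices x) ->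
  nest d j a u.
Proof.
elim: j x a u => // j IH x a u.
case: x => [t | [t v]].
  case/tupleP: t => e t /=; rewrite is_nesting_cons => /and3P[eA et dt].
  rewrite all_cat /= => /and4P[/andP[ae _] _ /andP[_ eu] _].
  apply: (nest_arc eA ae eu (IH (inl t) _ _ _ _)) => //=; rewrite all_cat !all_map.
  (* Nesting inside [e] bounds [f.1] below and [f.2] above; [f.1 < f.2] supplies the other two
     bounds. *)
  have ltt : all (fun f : 'I_n * 'I_n => f.1 < f.2) t.
    by case/andP: dt => /allP dt _; apply/allP => f /dt /arc_lt.
  apply/andP; split; apply/allP => f ft /=;
    by move/allP/(_ _ ft): et; move/allP/(_ _ ft): ltt => /=; lia.
case: j IH t => [|j] IH t /=.
  move=> /and3P[_ fv _] /andP[auv _].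
  exact: nest_fixed auv.
case/tupleP: t => e t /=; rewrite is_nesting_cons.
move=> /and4P[/and3P[eA et dt] fv ev tv].
rewrite all_cat /= => /and5P[auv /andP[ae _] _ /andP[_ eu] _].
apply: (nest_arc eA ae eu (IH (inr (t, v)) _ _ _ _)) => /=; first by apply/and3P.
rewrite ev all_cat !all_map /=.
have ltt : all (fun f : 'I_n * 'I_n => f.1 < f.2) t.
  by case/andP: dt => /allP dt _; apply/allP => f /dt /arc_lt.
apply/andP; split; apply/allP => f ft /=;
  by move/allP/(_ _ ft): et; move/allP/(_ _ ft): ltt => /=; lia.
Qed.

Lemma nestP j a u :
  reflect (exists x : enhanced_config n j, is_enhanced_nesting d x
             && all (fun v : 'I_n => a <= v < u) (config_vertices x))
          (nest d j a u).
Proof.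
apply: (iffP idP) => [|[x /andP[]]]; last exact: nest_config.
elim: j a u => [|j IH] a u; first by exists (inl [tuple]).
case/nestSP=> [[e [eA ae eu /IH[]]] | [-> [v [fv av]]]]; last first.
  exists (inr ([tuple], v)).
  by rewrite /= fv av.
have lte := arc_lt eA.
have au1 : a <= e.1 < u by lia.
have au2 : a <= e.2 < u by lia.
have inside1 (v : 'I_n) : e.1 < v < e.2 -> a <= v < u by lia.
have inside (f : 'I_n * 'I_n) : e.1 < f.1 < e.2 -> e.1 < f.2 < e.2 ->
    [/\ (e.1 < f.1) && (f.2 < e.2), a <= f.1 < u & a <= f.2 < u].
  by split; lia.
case=> [t|[t v]] /andP[]; rewrite /= all_cat !all_map.
  move=> dt /andP[t1 t2]; exists (inl (cons_tuple e t)).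
  rewrite /= is_nesting_cons eA dt all_cat /= !all_map andbT /=.
  apply/and5P; split; [|exact: au1| |exact: au2|]; apply/allP=> f ft;
    by case: (inside f (allP t1 f ft) (allP t2 f ft)).
case/and4P=> j0 dt fv tv /and3P[ve t1 t2].
(* Once [j = 0] is excluded, the predecessor in the tuple length is genuine, so prepending [e] gives
   a tuple of the required length. *)
case: j j0 t dt tv t1 t2 {IH} => // j _ t dt tv t1 t2.
exists (inr (cons_tuple e t, v)).
rewrite /= is_nesting_cons eA dt fv tv all_cat /= !all_map !andbT ve inside1 //.
rewrite au1 au2 /= andbT; apply/and3P; split; apply/allP=> f ft;
  by case: (inside f (allP t1 f ft) (allP t2 f ft)).
Qed.

Lemma has_enhanced_nestingE j : has_enhanced_nesting j d = nest d j 0 n.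
Proof.
apply/existsP/nestP => -[x]; exists x; last by case/andP: p.
by rewrite p; apply/allP => v _ /=.
Qed.

Lemma in_future_enhanced_nestingE j a :
  in_future_enhanced_nesting j.+1 d a = (a \in semiarcs d) && nest d j a.+1 n.
Proof.
rewrite /in_future_enhanced_nesting /=; congr andb.
apply/existsP/nestP => -[x /andP[dx xa]]; exists x; rewrite dx /=.
  by apply: sub_all xa => v; rewrite ltn_ord andbT.
by apply: sub_all xa => v /andP[].
Qed.

(** Turns the maximum into a threshold: [nest] is monotone in its depth by [nest_le], and
    [nest_bound] shows that the range of the maximum omits no depth. Depth 0 matches the default
    value 0. *)
Lemma leq_enhanced_nesting_index a i : a \in semiarcs d ->
  (i <= enhanced_nesting_index d a) = nest d i a.+1 n.
Proof.
move=> aS; apply/idP/idP; last first.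
  move=> di; have i_lt : i < n.+1.
    by case: i di => // i /(nest_bound (ltn0Sn _)); lia.
  apply: (@leq_bigmax_cond _ _ (fun j : 'I_n.+1 => j : nat) (Ordinal i_lt)).
  by rewrite in_future_enhanced_nestingE aS.
case: i => // i; apply: contraTT => Ndi; rewrite -ltnNge ltnS.
apply/bigmax_leqP => j; rewrite in_future_enhanced_nestingE aS /= => dj.
by rewrite leqNgt; apply: contra Ndi => ij; apply: nest_le dj.
Qed.

Lemma mem_Pi_tilde k :
  (d \in Pi_tilde k n) =
  ~~ nest d k.+1 0 n && [forall a in semiarcs d, ~~ nest d k a.+1 n].
Proof.
rewrite inE has_enhanced_nestingE negb_exists; congr andb.
by apply: eq_forallb => a; rewrite in_future_enhanced_nestingE negb_and implybE.
Qed.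

End NestTheory.

(** * Extension of a diagram by a last vertex *)

Lemma fixed_pointP n (d : open_diagram n) v :
  reflect [/\ v \notin semiarcs d, forall w, (v, w) \notin arcs d
            & forall w, (w, v) \notin arcs d]
          (fixed_point d v).
Proof.
apply: (iffP andP) => [[vS /'forall_implyP vA]|[vS v1 v2]].
  by split=> // w; apply/negP => /vA /=; rewrite eqxx ?andbF.
split=> //; apply/'forall_implyP => -[x y] xy /=.
apply/andP; split; first by apply: contraL xy => /eqP->.
by apply: contraL xy => /eqP->.
Qed.

Lemma bump_max n (i : 'I_n) : bump n i = i.
Proof. exact: lift_max. Qed.

Section Extension.

Variables (n : nat) (d : open_diagram n) (o : option 'I_n) (b : bool).

Local Notation up := (lift ord_max).

(** A diagram on [n.+1] vertices arises from one on [n] vertices by adding a last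
    vertex, which closes the semi-arc [o] (if any) and opens a semi-arc if [b];
    a value of [o] which is not a semi-arc of [d] is ignored. *)
Definition ext_arcs : {set 'I_n.+1 * 'I_n.+1} :=
  [set e | match unlift ord_max e.1, unlift ord_max e.2 with
           | Some a, Some c => (a, c) \in arcs d
           | Some a, None => (a \in semiarcs d) && (o == Some a)
           | None, _ => false
           end].

Definition ext_semiarcs : {set 'I_n.+1} :=
  [set v | if unlift ord_max v is Some a
           then (a \in semiarcs d) && (o != Some a) else b].

Lemma ext_is_open_diagram : is_open_diagram ext_arcs ext_semiarcs.
Proof.
case/is_open_diagramP: (diagramP d) => ltA outA semA inA.
apply/is_open_diagramP; split.
- move=> [x y]; rewrite inE /=.
  case: unliftP => // a ->; case: unliftP => [c ->|->] /=.
    by move/ltA; rewrite /= !bump_max.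
  by rewrite /= bump_max.
- move=> x y y'; rewrite !inE /=.
  case: unliftP => // a _; case: unliftP => [c ->|->]; case: unliftP => [c' ->|->] //.
  + by move=> ac ac'; rewrite (outA _ _ _ ac ac').
  + by move/semA=> /negbTE; rewrite /semiarcs => ->.
  + by move=> + /semA => /andP[aS]; rewrite -/(semiarcs d) aS.
- move=> x y; rewrite !inE /=; case: unliftP => // a _; case: unliftP => [c _|_].
    by move/semA => /negbTE; rewrite /semiarcs => ->.
  by case/andP=> _ ->; rewrite andbF.
- move=> x x' y; rewrite !inE /=.
  case: (unliftP ord_max x) => // a ->; case: (unliftP ord_max x') => // a' ->.
  case: unliftP => [c _|_].
    by move=> ac a'c; rewrite (inA _ _ _ ac a'c).
  by move=> /andP[_ /eqP->] /andP[_ /eqP[->]].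
Qed.

Definition ext : open_diagram n.+1 :=
  @OpenDiagram _ (ext_arcs, ext_semiarcs) ext_is_open_diagram.

Lemma ext_arc_up a c : ((up a, up c) \in arcs ext) = ((a, c) \in arcs d).
Proof. by rewrite inE /= !liftK. Qed.

Lemma ext_arc_max a :
  ((up a, ord_max) \in arcs ext) = (a \in semiarcs d) && (o == Some a).
Proof. by rewrite inE /= liftK unlift_none. Qed.

Lemma ext_arc_max1 v : ((ord_max, v) \in arcs ext) = false.
Proof. by rewrite inE /= unlift_none. Qed.

Lemma ext_semiarc_up a :
  (up a \in semiarcs ext) = (a \in semiarcs d) && (o != Some a).
Proof. by rewrite inE /= liftK. Qed.

Lemma ext_semiarc_max : (ord_max \in semiarcs ext) = b.
Proof. by rewrite inE /= unlift_none. Qed.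

(** Closing a semi-arc replaces it by an arc with the same left end, so that end is a fixed point
    neither before nor after. *)
Lemma ext_fixed_up v : fixed_point ext (up v) = fixed_point d v.
Proof.
apply/fixed_pointP/fixed_pointP => -[vS v1 v2].
  split=> [|w|w]; try by rewrite -ext_arc_up.
  by move: vS (v1 ord_max); rewrite ext_semiarc_up ext_arc_max; case: (v \in _);
    case: eqP.
split=> [|w|w]; first by rewrite ext_semiarc_up (negbTE vS).
  by case: (unliftP ord_max w) => [c|] ->;
    rewrite ?ext_arc_up // ext_arc_max (negbTE vS).
by case: (unliftP ord_max w) => [c|] ->; rewrite ?ext_arc_up // ext_arc_max1.
Qed.

Lemma ext_fixed_max :
  fixed_point ext ord_max = ~~ b && (if o is Some c then c \notin semiarcs d else true).
Proof.
apply/fixed_pointP/andP=> [[]|[Nb Nc]].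
  rewrite ext_semiarc_max => Nb _ v2; split=> //; case oE: o => [c|//].
  by apply: contra (v2 (up c)) => cS; rewrite ext_arc_max cS oE eqxx.
split; rewrite ?ext_semiarc_max // => w; rewrite ?ext_arc_max1 //.
case: (unliftP ord_max w) => [c|] ->; rewrite ?ext_arc_max1 // ext_arc_max.
by apply/negP => /andP[cS /eqP oc]; move: Nc; rewrite oc cS.
Qed.

(** A window ending at or before [n] excludes the new vertex, hence also the new arc. *)
Lemma nest_ext_inner j a u : u <= n -> nest ext j a u = nest d j a u.
Proof.
move=> un; elim: j a u un => // j IH a u un.
apply/idP/idP => /nestSP[[[x y]]|[-> [v]]].
- case=> + ax yu dj; case: (unliftP ord_max y) dj yu => [y' ->|-> _ /=]; last by lia.
  case: (unliftP ord_max x) ax => [x' ->|->]; last by rewrite ext_arc_max1.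
  rewrite /= ext_arc_up !bump_max => ax dj yu xyA.
  by apply: (nest_arc xyA) => //; rewrite -IH // ltnW.
- case: (unliftP ord_max v) => [v' ->|->]; last by case=> _ /andP[_ /=]; lia.
  rewrite ext_fixed_up lift_max => -[fv av]; exact: nest_fixed av.
- case=> xy ax yu dj; apply: (@nest_arc _ _ _ _ _ (up x, up y));
  rewrite ?ext_arc_up /= ?bump_max //.
  by rewrite IH // ltnW // (leq_trans yu).
- case=> fv av; apply: (@nest_fixed _ _ _ _ (up v)); by rewrite ?ext_fixed_up ?lift_max.
Qed.

(** Nothing lies to the right of the last vertex. A nesting that uses it therefore has the new arc
    as its outermost element, or consists of the new fixed point alone. *)
Lemma nest_ext j a :
  nest ext j.+1 a n.+1 =
  [|| nest d j.+1 a n,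
      if o is Some c then [&& c \in semiarcs d, a <= c & nest d j c.+1 n] else false
    | [&& j == 0, fixed_point ext ord_max & a <= n]].
Proof.
apply/idP/idP => [/nestSP[[[x y]]|[-> [v]]]|].
- case; case: (unliftP ord_max x) => [x' ->|->]; last by rewrite ext_arc_max1.
  rewrite /= bump_max; case: (unliftP ord_max y) => [y' ->|->].
    rewrite ext_arc_up lift_max => xy ax _ dj; apply/orP; left.
    by apply: nest_arc xy ax _ _ => //=; rewrite -nest_ext_inner // ltnW.
  rewrite ext_arc_max => /andP[xS /eqP ->] ax _;
    rewrite nest_ext_inner // xS ax => -> /=.
  by rewrite orbT.
- case: (unliftP ord_max v) => [v' ->|->].
    rewrite ext_fixed_up lift_max => -[fv /andP[av _]]; apply/orP; left.
    by apply: nest_fixed fv _; rewrite av /=.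
  by case=> -> /andP[-> _]; rewrite !orbT.
case/or3P.
- rewrite -(@nest_ext_inner j.+1 a n) // => /nestSP[[e [eA ae en dj]]|[-> [v [fv av]]]].
    by apply: nest_arc eA ae _ dj; rewrite ltnW.
  by apply: nest_fixed fv _; lia.
- case oE: o => [c|//] /and3P[cS ac dj].
  apply: (@nest_arc _ _ _ _ _ (up c, ord_max)) => //=; rewrite ?bump_max //.
    by rewrite ext_arc_max cS oE /=.
  by rewrite nest_ext_inner.
by case/and3P=> /eqP-> fm an; apply: (@nest_fixed _ _ _ _ ord_max) => //=; lia.
Qed.

End Extension.

(** * Unique decomposition by removal of the last vertex *)

(** Rules out the values of [o] that [ext] ignores, which would otherwise destroy injectivity. *)
Definition closable n (d : open_diagram n) (o : option 'I_n) :=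
  if o is Some c then c \in semiarcs d else true.

Lemma open_diagram_eq n (d d' : open_diagram n) :
  arcs d =i arcs d' -> semiarcs d =i semiarcs d' -> d = d'.
Proof.
move=> /setP eqA /setP eqS; apply: val_inj => /=.
by rewrite [LHS]surjective_pairing [RHS]surjective_pairing; congr pair.
Qed.

(** A semi-arc of [d] is either closed, and seen as an arc into the last vertex, or kept as a
    semi-arc; together these two observations recover [semiarcs d] and [o]. *)
Lemma ext_inj n (d d' : open_diagram n) o o' b b' :
  closable d o -> closable d' o' -> ext d o b = ext d' o' b' ->
  [/\ d = d', o = o' & b = b'].
Proof.
move=> ho ho' eq_ext.
have eq_close a : (a \in semiarcs d) && (o == Some a)
    = (a \in semiarcs d') && (o' == Some a).
  by rewrite -(ext_arc_max d o b) eq_ext ext_arc_max.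
have eq_keep a : (a \in semiarcs d) && (o != Some a)
    = (a \in semiarcs d') && (o' != Some a).
  by rewrite -(ext_semiarc_up d o b) eq_ext ext_semiarc_up.
split; last by rewrite -(ext_semiarc_max d o b) eq_ext ext_semiarc_max.
- apply: open_diagram_eq => [[x y]|a].
    by rewrite -(ext_arc_up d o b) eq_ext ext_arc_up.
  by move: (eq_close a) (eq_keep a); case: (o == _); case: (o' == _);
    rewrite ?andbT ?andbF // => -> // <-.
- case: o ho {eq_keep eq_ext} eq_close => [c|] /= hc eq_close.
    by move: (eq_close c); rewrite hc eqxx => /esym/andP[_ /eqP].
  case: o' ho' eq_close => // c /= hc' /(_ c).
  by rewrite hc' eqxx andbF.
Qed.

(** Restrict to the first [n] vertices and reopen the arc into the last vertex, if there is one, as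
    a semi-arc. *)
Lemma ext_surj n (d' : open_diagram n.+1) :
  exists d o b, closable d o /\ d' = ext d o b.
Proof.
case/is_open_diagramP: (diagramP d'); rewrite -/(arcs d') -/(semiarcs d').
move=> ltA outA semA inA; pose up := lift (@ord_max n).
pose A := [set e : 'I_n * 'I_n | (up e.1, up e.2) \in arcs d'].
pose S := [set a | (up a \in semiarcs d') || ((up a, ord_max) \in arcs d')].
have AS : is_open_diagram A S.
  apply/is_open_diagramP; split.
  - by move=> e; rewrite inE => /ltA; rewrite /= !bump_max.
  - by move=> a y y'; rewrite !inE /= => h /(outA _ _ _ h) /lift_inj.
  - move=> a y; rewrite !inE /= => ay; rewrite (negbTE (semA _ _ ay)) /=.
    by apply/negP => /(outA _ _ _ ay)/eqP; rewrite eq_sym (negbTE (neq_lift _ _)).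
  - by move=> a y y'; rewrite !inE /= => h /(inA _ _ _ h) /lift_inj.
pose d := @OpenDiagram n (A, S) AS.
pose o := [pick a | (up a, ord_max) \in arcs d'].
have oP a : (o == Some a) = ((up a, ord_max) \in arcs d').
  rewrite /o; case: pickP => [c ca|->//].
  by apply/eqP/idP => [[<-]//|/(inA _ _ _ ca)/lift_inj->].
exists d, o, (ord_max \in semiarcs d'); split.
  case oE: o => [c|//] /=; rewrite inE /= -oP oE eqxx orbT //.
apply: open_diagram_eq => [[x y]|x].
  case: (unliftP ord_max x) => [a ->|->].
    case: (unliftP ord_max y) => [c ->|->]; first by rewrite ext_arc_up inE.
    by rewrite ext_arc_max oP inE /= andb_idl // orbC => ->.
  rewrite ext_arc_max1; apply/negbTE/negP => /ltA /=.
  by have := ltn_ord y; lia.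
case: (unliftP ord_max x) => [a ->|->]; last by rewrite ext_semiarc_max.
rewrite ext_semiarc_up oP inE /= andb_orl andbN orbF andb_idr //.
by move=> aS; apply/negP => /semA; rewrite aS.
Qed.

(** * Labels and ranks of semi-arcs *)

Section Labels.

Variables (n : nat) (d : open_diagram n).

Definition label_entry m := #|[set a in semiarcs d | nest d m a.+1 n]|.

(** By [nest_rank] below, the semi-arcs of index at least [m] are the first
    [label_entry m] ones from the left: a position determines an index. *)
Definition rank (c : 'I_n) := #|[set a in semiarcs d | a < c]|.

Lemma diagram_labelE k : diagram_label k d = mkseq label_entry k.
Proof.
apply: eq_map => m; apply: eq_card => a; rewrite !inE.
by case: (boolP (a \in semiarcs d)) => // aS; rewrite leq_enhanced_nesting_index.
Qed.

(** By [nest_weaken], the semi-arcs counted by [label_entry m] form an initial segment of all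
    semi-arcs, so membership is decided by position. *)
Lemma nest_rank m c : c \in semiarcs d -> nest d m c.+1 n = (rank c < label_entry m).
Proof.
move=> cS; apply/idP/idP => [dm|].
  apply/proper_card/properP; split.
    apply/subsetP => a; rewrite !inE => /andP[-> ac] /=.
    by apply: nest_weaken dm; rewrite ltnS ltnW.
  by exists c; rewrite !inE ?ltnn ?andbF // cS.
apply: contraTT => Ndm; rewrite -leqNgt; apply/subset_leq_card/subsetP => a.
rewrite !inE => /andP[-> da] /=; rewrite ltnNge; apply: contra Ndm => ca.
exact: nest_weaken da.
Qed.

Lemma label_entry0 : label_entry 0 = #|semiarcs d|.
Proof. by apply: eq_card => a; rewrite inE andbT. Qed.

Lemma label_entry_le m m' : m <= m' -> label_entry m' <= label_entry m.
Proof.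
move=> mm'; apply/subset_leq_card/subsetP => a; rewrite !inE => /andP[->].
exact: nest_le.
Qed.

Lemma rank_lt (a c : 'I_n) : a \in semiarcs d -> a < c -> rank a < rank c.
Proof.
move=> aS ac; apply/proper_card/properP; split.
  by apply/subsetP => x; rewrite !inE => /andP[-> xa]; rewrite (ltn_trans xa).
by exists a; rewrite !inE ?ltnn ?andbF // aS.
Qed.

Lemma rank_inj : {in semiarcs d &, injective rank}.
Proof.
move=> a c aS cS eq_rank; apply: val_inj => /=.
by case: (ltngtP a c) => // [/(rank_lt aS)|/(rank_lt cS)]; rewrite eq_rank ltnn.
Qed.

(** Pigeonhole: the ranks are distinct and lie in an interval with as many elements as there are
    semi-arcs. *)
Lemma rank_surj i : i < #|semiarcs d| -> exists2 c, c \in semiarcs d & rank c = i.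
Proof.
move=> i_lt; have uniq_rank : uniq [seq rank c | c <- enum (semiarcs d)].
  rewrite map_inj_in_uniq ?enum_uniq // => a c.
  rewrite !mem_enum; exact: rank_inj.
have sub : {subset [seq rank c | c <- enum (semiarcs d)] <= iota 0 #|semiarcs d|}.
  move=> x /mapP[c]; rewrite mem_enum => cS ->.
  (* At depth 0, where [nest] is trivially true, [nest_rank] bounds each rank by the number of
     semi-arcs. *)
  by rewrite mem_iota /= -label_entry0 -nest_rank.
have [] := uniq_min_size uniq_rank sub; first by rewrite size_iota size_map -cardE.
move=> _ /(_ i); rewrite mem_iota i_lt => /mapP[c].
by rewrite mem_enum => cS ->; exists c.
Qed.

End Labels.

(** * Labels of extended diagrams *)

Section ExtLabels.

Variables (n : nat) (d : open_diagram n).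

(** A semi-arc opened at the last vertex has no vertex to its right, so it counts in entry 0
    only. *)
Lemma label_entry_ext o b m :
  label_entry (ext d o b) m =
  #|[set a in semiarcs d | (o != Some a) && nest (ext d o b) m a.+1 n.+1]|
  + (b && (m == 0)).
Proof.
pose X := [set a in semiarcs d | (o != Some a) && nest (ext d o b) m a.+1 n.+1].
(* The last summand is realised as a set, empty or [{ord_max}], disjoint from the lifted old
   semi-arcs. *)
pose Y := [set v : 'I_n.+1 | [&& v == ord_max, b & m == 0]].
rewrite -/X /label_entry.
have -> : (b && (m == 0) : nat) = #|Y|.
  rewrite /Y; case: (b && (m == 0)).
    by rewrite (_ : [set _ | _] = [set ord_max]) ?cards1 //; apply/setP => v;
      rewrite !inE andbT.
  by rewrite (_ : [set _ | _] = set0) ?cards0 //; apply/setP => v; rewrite !inE andbF.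
rewrite -(card_imset X (@lift_inj _ ord_max)) -cardsUI.
rewrite (_ : _ :&: Y = set0); last first.
  apply/setP => v; rewrite !inE; apply/negP => /andP[/imsetP[a _ ->]].
  by rewrite eq_sym (negbTE (neq_lift _ _)).
rewrite cards0 addn0; congr #|pred_of_set _|; apply/setP => v.
case: (unliftP ord_max v) => [a ->|->].
  rewrite in_setU mem_imset; last exact: lift_inj.
  rewrite !inE liftK lift_max [lift _ _ == _]eq_sym (negbTE (neq_lift _ _)) orbF.
  by rewrite andbA.
rewrite in_setU !inE unlift_none eqxx /=.
have -> : (ord_max \in [set lift ord_max x | x in X]) = false.
  by apply/negP => /imsetP[a _ /eqP]; rewrite (negbTE (neq_lift _ _)).
case: b {X Y} => //=; case: m => [|m]//; apply/negP => /(nest_bound (ltn0Sn m)).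
by lia.
Qed.

(** The new fixed point is an enhanced 1-nesting to the right of every semi-arc, and it has no arc
    around it to give a deeper one. *)
Lemma label_entry_ext_fixed m :
  label_entry (ext d None false) m =
  if m == 1 then label_entry d 0 else label_entry d m.
Proof.
rewrite label_entry_ext addn0; case: m => [|m].
  by apply: eq_card => a; rewrite !inE.
case: eqP => [[->]|m1]; apply: eq_card => a; rewrite !inE nest_ext ext_fixed_max /=.
  by rewrite ltn_ord orbT.
by case: eqP m1 => [->//|_ _]; rewrite orbF.
Qed.

Lemma label_entry_ext_open m :
  label_entry (ext d None true) m =
  if m == 0 then (label_entry d 0).+1 else label_entry d m.
Proof.
rewrite label_entry_ext; case: m => [|m]; first by rewrite addn1; congr _.+1;
  apply: eq_card => a; rewrite !inE.
by rewrite addn0; apply: eq_card => a; rewrite !inE nest_ext ext_fixed_max /=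
  andbF orbF.
Qed.

Lemma label_entry_ext_close c b m : c \in semiarcs d ->
  label_entry (ext d (Some c) b) m =
  if b && (m == 0) then label_entry d 0
  else if m < (enhanced_nesting_index d c).+1 then (label_entry d m).-1
  else if m == (enhanced_nesting_index d c).+1 then rank d c else label_entry d m.
Proof.
move=> cS; rewrite label_entry_ext.
have idxE := leq_enhanced_nesting_index _ cS.
have closeE a j : nest (ext d (Some c) b) j.+1 a.+1 n.+1 =
    nest d j.+1 a.+1 n || (a < c) && (j <= enhanced_nesting_index d c).
  by rewrite nest_ext cS ext_fixed_max cS !andbF orbF /= idxE.
(* [c] itself is counted in the entries up to its own index, so removing it lowers exactly these by
   one. *)
have le_entry j : j <= enhanced_nesting_index d c ->
    #|[set a in semiarcs d | (Some c != Some a) && nest d j a.+1 n]| =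
      (label_entry d j).-1.
  move=> jc; rewrite /label_entry (cardsD1 c [set a in _ | nest d j _ _]) !inE cS -idxE jc /=.
  by apply: eq_card => a; rewrite !inE (inj_eq Some_inj) eq_sym; do !bool_congr.
case: m => [|m].
  have -> : #|[set a in semiarcs d |
      (Some c != Some a) && nest (ext d (Some c) b) 0 a.+1 n.+1]|
      = (label_entry d 0).-1 by rewrite -le_entry.
  case: b {closeE} => /=; last by rewrite addn0.
  (* The opened semi-arc makes up for the closed one; entry 0 is positive because it counts [c]. *)
  by rewrite addn1 prednK // label_entry0; apply/card_gt0P; exists c.
rewrite !andbF addn0 !ltnS.
rewrite eqSS; case: ltngtP => [m_lt|m_gt|mE].
(* The entry treated is [m.+1]. Up to the index of [c], semi-arcs left of [c] were already counted
   by weakening; beyond the index plus one, nothing is gained and [c] was not counted. *)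
- rewrite -le_entry //; apply: eq_card => a; rewrite !inE closeE.
  rewrite orb_idr // => /andP[ac _]; apply: (@nest_weaken _ _ _ c.+1).
    by rewrite ltnS ltnW.
  by rewrite -idxE.
- apply: eq_card => a; rewrite !inE closeE [m <= _]leqNgt m_gt andbF orbF.
  case: (eqVneq a c) => [->|ac]; last by rewrite (inj_eq Some_inj) eq_sym ac.
  by rewrite eqxx -idxE leqNgt ltnS (ltnW m_gt) /= andbF.
(* At the index plus one, [c] was not counted before, so neither was any semi-arc to its right:
   exactly those left of [c] remain. *)
- apply: eq_card => a; rewrite !inE closeE mE leqnn andbT.
  case: (boolP (a \in _)) => //= aS; rewrite (inj_eq Some_inj).
  have -> : nest d (enhanced_nesting_index d c).+1 a.+1 n || (a < c) = (a < c).
    apply: orb_idl => da; rewrite ltnNge; apply/negP => ca.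
    by have := nest_weaken (ca : c.+1 <= a.+1) da; rewrite -idxE ltnn.
  by case: (eqVneq c a) => [->|//]; rewrite ltnn.
Qed.

End ExtLabels.

(** * Admissible moves and the succession rule *)

Section Children.

Variables (n : nat) (d : open_diagram n).

(** In [Pi_tilde k n] the index is at most [k.-1]; at this value closing is allowed only for the
    leftmost semi-arc, which has rank 0. *)
Definition can_close k (c : 'I_n) :=
  (enhanced_nesting_index d c < k.-1) || (rank d c == 0).

Definition moves k : seq (option 'I_n * bool) :=
  [:: (None, false); (None, true)]
  ++ [seq (Some c, true) | c <- enum [set c in semiarcs d | can_close k c]]
  ++ [seq (Some c, false) | c <- enum [set c in semiarcs d | can_close k c]].

Lemma mem_moves k o b :
  ((o, b) \in moves k) = if o is Some c then (c \in semiarcs d) && can_close k c else true.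
Proof.
rewrite !inE !mem_cat; case: o => [c|]; last by case: b.
have inSome b' :
    (Some c, b) \in [seq (Some c, b') | c <- enum [set c in semiarcs d | can_close k c]]
    = (b == b') && (c \in semiarcs d) && can_close k c.
  apply/mapP/idP => [[c']|/andP[/andP[/eqP-> cS] cc]].
    by rewrite mem_enum inE => /andP[cS cc] [-> ->]; rewrite eqxx cS.
  by exists c => //; rewrite mem_enum inE cS.
by rewrite !inSome; case: b {inSome} => /=; rewrite ?orbF.
Qed.

Lemma uniq_moves k : uniq (moves k).
Proof.
have uniqSome b :
    uniq [seq (Some c, b) | c <- enum [set c in semiarcs d | can_close k c]].
  by rewrite map_inj_uniq ?enum_uniq // => x y [].
rewrite /moves !cat_uniq !uniqSome -!all_predC all_cat !all_map.
by apply/and5P; split=> //; [apply/andP; split|]; apply/allP => c _ //=;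
  apply/mapP => -[].
Qed.

(** An enhanced nesting of depth [k.+1] under a new arc at [c] would already make [c] violate the
    future condition in [d]. A new fixed point alone has depth 1, harmless since [k] is at least
    2. *)
Lemma mem_Pi_tilde_ext k o b : 2 <= k -> closable d o ->
  (ext d o b \in Pi_tilde k n.+1) = (d \in Pi_tilde k n) && ((o, b) \in moves k).
Proof.
rewrite mem_moves !mem_Pi_tilde; case: k => // -[|k] // _.
case: o => [c|] /= oS.
  rewrite nest_ext oS ext_fixed_max oS !andbF !orbF /= negb_or -!andbA.
  congr andb; apply/andP/andP.
  - case=> Ndc /'forall_implyP Pext; split.
      (* [c] is no longer a semi-arc of the extension; its condition comes from [Ndc], the absence
         of a deep nesting beneath the new arc. *)
      apply/'forall_implyP => a aS; case: (eqVneq a c) => [->//|ac].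
      have := Pext (lift ord_max a);
        rewrite ext_semiarc_up aS (inj_eq Some_inj) eq_sym ac lift_max.
      by rewrite nest_ext negb_or => /(_ isT) /andP[].
    rewrite /can_close; case: ltnP => //= idx_ge.
    rewrite cards_eq0; apply/eqP/setP => a; rewrite !inE; apply/negP => /andP[aS ac].
    have := Pext (lift ord_max a); rewrite ext_semiarc_up aS (inj_eq Some_inj) eq_sym.
    rewrite neq_ltn ac lift_max nest_ext oS ac -(leq_enhanced_nesting_index _ oS) idx_ge /=.
    by rewrite orbT => /(_ isT).
  - case=> /'forall_implyP Pd cc; split; first exact: Pd.
    apply/'forall_implyP => v; case: (unliftP ord_max v) => [a ->|-> _]; last first.
      by apply/negP => /nest_bound /=; lia.
    rewrite ext_semiarc_up lift_max nest_ext oS ext_fixed_max oS !andbF orbF /=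
      => /andP[aS _].
    rewrite negb_or Pd //= -leq_enhanced_nesting_index //; apply/negP => /andP[ac].
    case/orP: cc => [|/eqP/eqP]; first by rewrite /= ltnNge => /negbTE ->.
    by rewrite cards_eq0 => /eqP/setP/(_ a); rewrite !inE aS ac.
rewrite nest_ext /= orbF andbT; congr andb.
apply/'forall_implyP/'forall_implyP => Pd a aS.
  have := Pd (lift ord_max a); rewrite ext_semiarc_up aS lift_max nest_ext orbF.
  exact.
case: (unliftP ord_max a) aS => [a' ->|-> _]; last by apply/negP => /nest_bound /=; lia.
by rewrite ext_semiarc_up lift_max nest_ext orbF andbT => /Pd.
Qed.

Variable k : nat.
Hypothesis hk : 2 <= k.

Let s m := nth 0 (diagram_label k d) m.

Lemma nth_diagram_label m : m < k -> s m = label_entry d m.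
Proof. by move=> mk; rewrite /s diagram_labelE nth_mkseq. Qed.

(** Pairs [(j, i)]: closing the semi-arc of rank [i] and index [j - 1] yields
    rules (3) and (4), or (5) when [j = k]. *)
Definition rule_positions : seq (nat * nat) :=
  [seq (j, i) | j <- index_iota 1 k, i <- index_iota (s j) (s j.-1)]
  ++ (if 0 < s k.-1 then [:: (k, 0)] else [::]).

(** Ranks separate semi-arcs, so both lists are duplicate-free and it suffices to compare members,
    translating index thresholds into rank thresholds by [idxE]. *)
Lemma perm_rule_positions : d \in Pi_tilde k n ->
  perm_eq [seq ((enhanced_nesting_index d c).+1, rank d c)
            | c <- enum [set c in semiarcs d | can_close k c]]
          rule_positions.
Proof.
rewrite mem_Pi_tilde => /andP[_ /'forall_implyP Pd].
have idx_lt c : c \in semiarcs d -> enhanced_nesting_index d c < k.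
  by move=> cS; rewrite ltnNge leq_enhanced_nesting_index ?Pd.
have idxE c m : c \in semiarcs d ->
    (m <= enhanced_nesting_index d c) = (rank d c < label_entry d m).
  by move=> cS; rewrite leq_enhanced_nesting_index ?nest_rank.
have k1k : k.-1 < k by lia.
apply: uniq_perm.
- rewrite map_inj_in_uniq ?enum_uniq // => c c'.
  rewrite !mem_enum !inE => /andP[cS _] /andP[c'S _] [_].
  exact: rank_inj.
- rewrite cat_uniq; apply/and3P; split; last by case: ifP.
    apply: allpairs_uniq_dep; rewrite ?iota_uniq //.
      by move=> j _; apply: iota_uniq.
    by move=> [j i] [j' i'] _ _ /= [-> ->].
  case: ifP => // _; rewrite /= orbF; apply/negP => /allpairsPdep[j [i []]].
  by rewrite mem_index_iota => + _ [kj _]; lia.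
move=> [j i]; rewrite mem_cat; apply/mapP/orP.
- case=> c; rewrite mem_enum inE => /andP[cS cc] [-> ->].
  have := idxE c (enhanced_nesting_index d c) cS; rewrite leqnn => /esym lt_s.
  have := idxE c (enhanced_nesting_index d c).+1 cS; rewrite ltnn => /esym/negbT.
  rewrite -leqNgt => ge_s.
  case: (ltnP (enhanced_nesting_index d c) k.-1) => [idx_k|idx_k].
    left; apply/allpairsPdep; exists (enhanced_nesting_index d c).+1, (rank d c).
    have idx_k' : (enhanced_nesting_index d c).+1 < k by lia.
    by rewrite !mem_index_iota /= !nth_diagram_label ?lt_s ?ge_s ?(ltnW idx_k') ?idx_k'.
  have idx_k1 : enhanced_nesting_index d c = k.-1 by have := idx_lt c cS; lia.
  move: cc lt_s; rewrite /can_close idx_k1 ltnn => /eqP -> lt_s; right.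
  by rewrite nth_diagram_label // lt_s inE prednK //; lia.
- have s0 j' : label_entry d j' <= #|semiarcs d|.
    by rewrite -label_entry0 label_entry_le.
  case=> [/allpairsPdep[j' [i' []]]|].
    rewrite !mem_index_iota => /andP[j1 jk] /andP[ge_s lt_s] [jE iE].
    subst j' i'; move: ge_s lt_s; rewrite !nth_diagram_label //; last by lia.
    (* The semi-arc of rank [i]; the two bounds on [i] force its index to be [j.-1]. *)
    move=> ge_s lt_s; have [c cS cE] := rank_surj (leq_trans lt_s (s0 _)).
    have idx_ge : j.-1 <= enhanced_nesting_index d c by rewrite idxE // cE.
    have idx_lt' : enhanced_nesting_index d c < j by rewrite ltnNge idxE // cE -leqNgt.
    exists c; last by rewrite cE; congr pair; lia.
    by rewrite mem_enum inE cS /can_close; apply/orP; left; lia.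
  case: ifP => // lt_s; rewrite inE => /eqP[-> ->].
  rewrite nth_diagram_label // in lt_s.
  have [c cS cE] := rank_surj (leq_trans lt_s (s0 _)).
  exists c; first by rewrite mem_enum inE cS /can_close cE orbT.
  have := idx_lt c cS; have := idxE c k.-1 cS; rewrite cE lt_s => *.
  by congr pair; lia.
Qed.

Lemma perm_children_labels : d \in Pi_tilde k n ->
  perm_eq [seq diagram_label k (ext d p.1 p.2) | p <- moves k]
          (enhanced_rule k (diagram_label k d)).
Proof.
move=> dP; have perm_pos := perm_rule_positions dP.
(* One formula for rules (3), (4) and (5); [b] tells whether the last vertex also opens a semi-arc.
   At [p.1 = k] no entry reaches the middle case, which gives rule (5). *)
pose F b (p : nat * nat) := mkseq (fun m =>
  if b && (m == 0) then s 0 else if m < p.1 then (s m).-1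
  else if m == p.1 then p.2 else s m) k.
have eq_mk (f g : nat -> nat) : (forall m, m < k -> f m = g m) -> mkseq f k = mkseq g k.
  by move=> fg; apply/eq_in_map => m; rewrite mem_iota => /andP[_ /fg].
have closeE b : perm_eq
    [seq diagram_label k (ext d p.1 p.2)
      | p <- [seq (Some c, b) | c <- enum [set c in semiarcs d | can_close k c]]]
    [seq F b p | p <- rule_positions].
  apply: perm_trans (perm_map (F b) perm_pos); rewrite -!map_comp.
  set X := map _ _; set Y := map _ _; suff -> : X = Y by exact: perm_refl.
  apply/eq_in_map => c; rewrite mem_enum inE => /andP[cS _] /=;
    rewrite diagram_labelE; apply: eq_mk => m mk.
  by rewrite label_entry_ext_close // !nth_diagram_label //; lia.
have k0 : 0 < k by lia.
rewrite /moves !map_cat.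
apply: perm_trans (perm_cat (perm_refl _) (perm_cat (closeE true) (closeE false))) _.
rewrite /rule_positions !map_cat !map_allpairs /enhanced_rule -/s.
have close5 b : [seq F b p | p <- if 0 < s k.-1 then [:: (k, 0)] else [::]] =
    if 0 < s k.-1 then [:: mkseq (fun m => if b && (m == 0) then s 0 else (s m).-1) k]
    else [::].
  by case: ifP => //= _; congr [:: _]; apply: eq_mk => m mk; rewrite mk.
rewrite !close5 /= !(diagram_labelE (ext _ _ _)).
have -> : mkseq (label_entry (ext d None false)) k =
    mkseq (fun m => if m == 1 then s 0 else s m) k.
  by apply: eq_mk => m mk; rewrite label_entry_ext_fixed !nth_diagram_label.
have -> : mkseq (label_entry (ext d None true)) k =
    mkseq (fun m => if m == 0 then (s 0).+1 else s m) k.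
  by apply: eq_mk => m mk; rewrite label_entry_ext_open !nth_diagram_label.
(* The two sides differ only in the place of the rule (5) labels, so comparing counts suffices. *)
rewrite !perm_cons; apply/permP => P; rewrite !count_cat.
pose A b := [seq F b (j, i) | j <- index_iota 1 k, i <- index_iota (s j) (s j.-1)].
pose A5 b := mkseq (fun m => if b && (m == 0) then s 0 else (s m).-1) k.
rewrite -[RHS]/(count P (A true) + (count P (A false)
  + count P (if 0 < s k.-1 then [:: A5 true; A5 false] else [::]))).
rewrite -/(A true) -/(A false) -/(A5 true) -/(A5 false).
by case: (0 < s k.-1) => /=; lia.
Qed.

End Children.

(** * Induction on the levels of the tree *)

Lemma perm_Pi_tilde_ext k n : 2 <= k ->
  perm_eq (enum (Pi_tilde k n.+1))
          [seq ext d p.1 p.2 | d <- enum (Pi_tilde k n), p <- moves d k].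
Proof.
move=> hk; have moves_closable (d : open_diagram n) o b :
    (o, b) \in moves d k -> closable d o.
  by rewrite mem_moves; case: o => //= c /andP[].
apply: uniq_perm; first exact: enum_uniq.
  apply: allpairs_uniq_dep; first exact: enum_uniq.
    by move=> d _; apply: uniq_moves.
  move=> _ _ /allpairsPdep[d [[o b] [_ ob ->]]] /allpairsPdep[d' [[o' b'] [_ ob' ->]]] /=.
  by case/(ext_inj (moves_closable _ _ _ ob) (moves_closable _ _ _ ob')) => -> -> ->.
move=> d'; rewrite mem_enum; apply/idP/allpairsPdep => [d'P|[d [[o b] [dP ob ->]]]].
  have [d [o [b [do_ dE]]]] := ext_surj d'; subst d'.
  move: d'P; rewrite mem_Pi_tilde_ext // => /andP[dP ob].
  by exists d, (o, b); rewrite mem_enum.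
by rewrite mem_Pi_tilde_ext ?(moves_closable _ _ _ ob) // -mem_enum dP.
Qed.

(** Sizes alone would not carry the induction, since the number of children depends on the label;
    the multisets of labels are compared instead. *)
Lemma perm_tree_level k n : 2 <= k ->
  perm_eq [seq diagram_label k d | d <- enum (Pi_tilde k n)]
          (tree_level (enhanced_rule k) (nseq k 0) n).
Proof.
move=> hk; elim: n => [|n IH] /=.
  have eq0 (d d' : open_diagram 0) : d = d'.
    by apply: open_diagram_eq => [[[]]|[]].
  have d0P : is_open_diagram (set0 : {set 'I_0 * 'I_0}) set0.
    by apply/is_open_diagramP; split=> [e|a b b'|a b|a a' b]; rewrite inE.
  pose d0 := @OpenDiagram 0 (set0, set0) d0P.
  have -> : Pi_tilde k 0 = [set d0].
    apply/setP => d; rewrite (eq0 d d0) mem_Pi_tilde !inE eqxx.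
    apply/andP; split; first by apply/negP => /nest_bound; lia.
    by apply/'forall_implyP => -[].
  rewrite enum_set1 /= diagram_labelE (_ : mkseq _ k = nseq k 0) ?perm_refl //.
  apply: (@eq_from_nth _ 0); rewrite size_mkseq ?size_nseq // => i ik.
  by rewrite nth_mkseq // nth_nseq ik; apply: eq_card0 => -[].
apply: perm_trans (perm_map _ (perm_Pi_tilde_ext n hk)) _.
rewrite map_allpairs.
apply: perm_trans (perm_flatten (perm_map (enhanced_rule k) IH)); rewrite -map_comp.
(* Kept as a hypothesis so that membership in [Pi_tilde] survives the induction over the list of
   diagrams. *)
have : {subset enum (Pi_tilde k n) <= Pi_tilde k n} by move=> d; rewrite mem_enum.
elim: (enum _) => [|d l IHl] sub; first exact: perm_refl.
apply: (perm_cat (perm_children_labels hk _)).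
  by apply: sub; rewrite mem_head.
by apply: IHl => d' d'l; apply: sub; rewrite inE d'l orbT.
Qed.

Theorem theorem7 (k : nat) (hk : 2 <= k) (n : nat) :
  #|Pi_tilde k n| = size (tree_level (enhanced_rule k) (nseq k 0) n).
Proof.
by rewrite -(perm_size (perm_tree_level n hk)) size_map -cardE.
Qed.
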